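(* There exists an open set $\hat{U}\subset \mathbb{R}^2$ such that: \begin{enumerate} \item $\hat{U}$ is connected and simply connected; \item $U=\pi(\hat{U})$ is simply connected, or equivalently, $\hat{U}$ is disjoint from $\hat{U}+v$ for all $v\in \mathbb{Z}^2$, $v\neq (0,0)$; \item $\hat{U}$ intersects every square $[0,1]^2 + v$, with $v\in \mathbb{R}^2$ (in particular, $\hat{U}$ accumulates in every direction at infinity); \item $U$ has full Lebesgue measure in $\mathbb{T}^2$. \end{enumerate}
   Context: $\mathbb{T}^2=\mathbb{R}^2/\mathbb{Z}^2$ with covering projection $\pi\colon\mathbb{R}^2\to\mathbb{T}^2$, and Lebesgue measure on $\mathbb{T}^2$ is the probability measure induced by Lebesgue measure on $\mathbb{R}^2$. A set $X\subset\mathbb{R}^2$ accumulates in the direction $v\in\mathbb{S}^1$ at infinity (where $\mathbb{S}^1$ is the unit circle in $\mathbb{R}^2$) if there is a sequence $\{x_n\}_{n\ge 0}$ in $X$ such that $\lim_{n\to\infty}\|x_n\|=\infty$ and $\lim_{n\to\infty}\frac{x_n-x_0}{\|x_n-x_0\|}=v$. *)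

(* Defs.v *)
(* MathComp-Analysis; the real numbers are an arbitrary [R : realType], and the
   plane is the product space [R * R]. *)
From HB Require Import structures.
From mathcomp Require Import all_boot all_order all_algebra generic_quotient.
From mathcomp Require Import all_classical all_reals all_analysis.

Set Implicit Arguments.
Unset Strict Implicit.
Unset Printing Implicit Defensive.
Import Order.TTheory GRing.Theory Num.Theory.
Import numFieldNormedType.Exports.
Local Open Scope classical_set_scope.
Local Open Scope ring_scope.
Local Open Scope quotient_scope.

Section plane.
Context {R : realType}.
Implicit Types (A : set (R * R)) (v x : R * R).

Definition translate v A : set (R * R) := [set x + v | x in A].

Definition unit_square : set (R * R) := `[0, 1] `*` `[0, 1].

(* The canonical norm `|x| of [R * R] is the sup norm; the unit circle and
   directions are taken with respect to the Euclidean one. *)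
Definition euclidean_norm x : R := Num.sqrt (x.1 ^+ 2 + x.2 ^+ 2).

Definition unit_circle : set (R * R) := [set v | euclidean_norm v = 1].

(* A accumulates in the direction v at infinity.  When x n = x 0 the
   normalised vector is 0; this happens for finitely many n only, since the norm
   of x n tends to infinity. *)
Definition clusters_in_direction A v :=
  exists x : nat -> R * R,
    [/\ forall n, A (x n),
        euclidean_norm (x n) @[n --> \oo] --> +oo &
        (euclidean_norm (x n - x 0%N))^-1 *: (x n - x 0%N) @[n --> \oo] --> v].

(* The inclusion of the lattice Z^2 in the plane. *)
Definition lattice_point (k : int * int) : R * R := (k.1%:~R, k.2%:~R).

Lemma lattice_point0 : lattice_point 0 = 0.
Proof. by []. Qed.

Lemma lattice_pointN (k : int * int) : lattice_point (- k) = - lattice_point k.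
Proof. by rewrite /lattice_point/= !mulrNz. Qed.

Lemma lattice_pointD (k l : int * int) :
  lattice_point (k + l) = lattice_point k + lattice_point l.
Proof. by rewrite /lattice_point/= !intrD. Qed.

Lemma open_measurable_plane A : open A -> measurable A.
Proof.
move=> oA.
pose box (q : (rat * rat) * (rat * rat)) : set (R * R) :=
  `]ratr q.1.1, ratr q.1.2[ `*` `]ratr q.2.1, ratr q.2.2[.
pose F q := if `[< box q `<=` A >] then box q else set0.
rewrite (_ : A = \bigcup_q F q); last first.
  apply/seteqP; split=> [[x y] Axy|z [q _]]; last first.
    by rewrite /F; case: asboolP => // + bz; exact.
  have : nbhs (x, y) A by exact: open_nbhs_nbhs.
  case=> -[B C] /= [] /nbhs_ballP[e/= e0 eB] /nbhs_ballP[f/= f0 fC] BCA.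
  have [a] : exists a : rat, ratr a \in `]x - e, x[ by apply: rat_in_itvoo; rewrite ltrBlDr ltrDl.
  have [b] : exists b : rat, ratr b \in `]x, x + e[ by apply: rat_in_itvoo; rewrite ltrDl.
  have [c] : exists c : rat, ratr c \in `]y - f, y[ by apply: rat_in_itvoo; rewrite ltrBlDr ltrDl.
  have [d] : exists d : rat, ratr d \in `]y, y + f[ by apply: rat_in_itvoo; rewrite ltrDl.
  rewrite !in_itv/= => /andP[yd df] /andP[fc cy] /andP[xb be] /andP[ea ax].
  exists ((a, b), (c, d)) => //.
  rewrite /F; case: asboolP => [_|[]]; first by split=> /=; rewrite in_itv/= ?ax ?cy.
  move=> [u v] [/=]; rewrite !in_itv/= => /andP[au ub] /andP[cv vd].
  apply: BCA; split=> /=; [apply: eB|apply: fC]; rewrite /ball/= ltr_distlC.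
    by rewrite (lt_trans ea)//= (lt_trans ub).
  by rewrite (lt_trans fc)//= (lt_trans vd).
apply: countable_bigcupT_measurable; first exact: countableP.
move=> q; rewrite /F; case: asboolP => // _.
exact: measurableX.
Qed.

End plane.

Section torus.
Variable R : realType.

Definition lattice_equiv (x y : R * R) : bool :=
  `[< exists v : int * int, y = x + lattice_point v >].

Let lattice_equiv_refl : reflexive lattice_equiv.
Proof. by move=> x; apply/asboolP; exists 0; rewrite lattice_point0 addr0. Qed.

Let lattice_equiv_sym : symmetric lattice_equiv.
Proof.
by move=> x y; apply/asboolP/asboolP => -[v ->]; exists (- v);
  rewrite lattice_pointN addrK.
Qed.

Let lattice_equiv_trans : transitive lattice_equiv.
Proof.
move=> y x z /asboolP[v ->] /asboolP[w ->]; apply/asboolP.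
by exists (v + w); rewrite lattice_pointD addrA.
Qed.

Definition lattice_equiv_rel :=
  EquivRel lattice_equiv
    lattice_equiv_refl lattice_equiv_sym lattice_equiv_trans.

(* The torus R^2 / Z^2 with its quotient topology. *)
Definition torus : Type := quotient_topology {eq_quot lattice_equiv_rel}.

HB.instance Definition _ := Topological.on torus.
HB.instance Definition _ := Quotient.on torus.
HB.instance Definition _ := isPointed.Build torus (\pi_torus 0).

(* The measurable sets of the torus are its Borel sets. *)
HB.instance Definition _ :=
  Measurable.copy torus (g_sigma_algebraType (@open torus)).

Definition torus_proj : R * R -> torus := \pi_torus.

Let RxR : measurableType _ := (measurableTypeR R * measurableTypeR R)%type.

Lemma measurable_torus_proj :
  measurable_fun [set: RxR] (torus_proj : RxR -> torus).
Proof.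
apply: (@measurability _ _ _ _ setT _ (@open torus)) => //.
move=> _ [U oU <-]; rewrite setTI; apply: open_measurable_plane.
by move/continuousP: (@pi_continuous _ {eq_quot lattice_equiv_rel}); exact.
Qed.

(* torus_proj restricts to a bijection from this square onto the torus, so that
   lebesgue_torus is the measure induced by that of the plane. *)
Definition fundamental_domain : set RxR := `[0, 1[ `*` `[0, 1[.

Lemma measurable_fundamental_domain : measurable fundamental_domain.
Proof. by apply: measurableX; exact: measurable_itv. Qed.

Definition lebesgue_plane : set RxR -> \bar R :=
  (@lebesgue_measure R \x @lebesgue_measure R)%E.

HB.instance Definition _ := Measure.on lebesgue_plane.

Definition lebesgue_torus : set torus -> \bar R :=
  pushforward (mrestr lebesgue_plane measurable_fundamental_domain)
    (torus_proj : RxR -> torus).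

Let lebesgue_torus0 : lebesgue_torus set0 = 0%E.
Proof. by apply: measure0; exact: measurable_torus_proj. Qed.

Let lebesgue_torus_ge0 A : (0 <= lebesgue_torus A)%E.
Proof. by apply: measure_ge0; exact: measurable_torus_proj. Qed.

Let lebesgue_torus_sigma_additive : semi_sigma_additive lebesgue_torus.
Proof.
by apply: measure_semi_sigma_additive; exact: measurable_torus_proj.
Qed.

HB.instance Definition _ := isMeasure.Build _ _ _ lebesgue_torus
  lebesgue_torus0 lebesgue_torus_ge0 lebesgue_torus_sigma_additive.

Let lebesgue_torus_setT : lebesgue_torus setT = 1%E.
Proof.
rewrite /lebesgue_torus /pushforward /mrestr preimage_setT setTI.
have m01 : lebesgue_measure (`[0, 1[ : set R) = 1%E.
  by rewrite lebesgue_measure_itv/= lte_fin ltr01 oppr0 adde0.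
rewrite /lebesgue_plane /fundamental_domain.
rewrite product_measure1E; [|exact: measurable_itv..].
by rewrite -[RHS]mule1; congr (_ * _)%E; exact: m01.
Qed.

HB.instance Definition _ :=
  Measure_isProbability.Build _ _ _ lebesgue_torus lebesgue_torus_setT.

End torus.
Arguments torus_proj {R}.
Arguments lebesgue_torus {R}.

Section simple_connectedness.
Variables (R : realType) (T : topologicalType).
Implicit Types A : set T.

Definition is_path A (g : R -> T) (x y : T) :=
  [/\ {within `[0, 1], continuous g}, g @` `[0, 1] `<=` A, g 0 = x & g 1 = y].

Definition path_connected A :=
  forall x y, A x -> A y -> exists g, is_path A g x y.

(* The loop g at x is homotopic in A to the constant loop at x, through a
   homotopy that keeps the endpoints fixed. *)
Definition null_homotopic A (g : R -> T) (x : T) :=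
  exists H : R * R -> T,
    [/\ {within `[0, 1] `*` `[0, 1], continuous H},
        H @` (`[0, 1] `*` `[0, 1]) `<=` A,
        {in `[0, 1], forall s, H (s, 0) = g s},
        {in `[0, 1], forall s, H (s, 1) = x} &
        {in `[0, 1], forall t, H (0, t) = x /\ H (1, t) = x}].

Definition simply_connected A :=
  path_connected A /\ forall g x, is_path A g x x -> null_homotopic A g x.

End simple_connectedness.

(* Main.v *)
Require Import Defs.
From HB Require Import structures.
From mathcomp Require Import all_boot all_order all_algebra generic_quotient.
From mathcomp Require Import all_classical all_reals all_analysis.
From mathcomp Require Import measurable_realfun zify ring lra.

Set Implicit Arguments.
Unset Strict Implicit.
Unset Printing Implicit Defensive.
Import Order.TTheory GRing.Theory Num.Theory.
Import numFieldNormedType.Exports.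
Local Open Scope classical_set_scope.
Local Open Scope ring_scope.

(** The domain is the image of the open unit square Q under an injective map L
    obtained as a limit of homeomorphisms of the plane that commute with the
    integer translations, preserve area and fix every lattice point.

    Suppose that such a homeomorphism H is given and that it will not be
    changed any more on a compact part of Q.  Near the grid of lines through
    the lattice points everything is still free: a horizontal shear supported
    near the horizontal lines followed by a vertical shear supported near the
    vertical lines carries a point of Q to a point as close as desired to any
    lattice point k.  Since H fixes k, composing H with these shears produces a
    homeomorphism that agrees with H on the protected part and sends a point of
    Q into any prescribed small square with lower left corner k
    ([toral_move_core]).  Because the new homeomorphism preserves area, the
    grid has a null image, so the image of a large enough part of Q covers
    almost all of the torus; protect that part and iterate, enumerating all
    lattice points and all scales ([toral_step], [toral_tower]).

    The sequence is eventually constant near each point of Q, so L is a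
    continuous open map on Q, and L y - L x is never a lattice vector for
    distinct x and y in Q, because each term of the sequence has this property
    ([limit_lattice]).  Both L and its composition with the projection to the
    torus are therefore open embeddings of the convex set Q, and simple
    connectedness is inherited from Q ([simply_connected_image]).  Every closed
    unit square contains a lattice point together with a small square having it
    as lower left corner, so it meets the image; the statement on directions
    follows by looking at the unit squares placed along a ray.  *)

(** * Open embeddings and simple connectedness *)

Lemma within_continuous_comp_in (S T T' : topologicalType) (I : set S) (A : set T)
    (g : S -> T) (f : T -> T') :
  {within I, continuous g} -> g @` I `<=` A ->
  (forall x, A x -> {for x, continuous f}) ->
  {within I, continuous (f \o g)}.
Proof.
move=> /subspace_continuousP cg gA cf; apply/subspace_continuousP => s Is.
apply: cvg_comp (cg s Is) _.
by apply: cf; apply: gA; exists s.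
Qed.

Section open_embedding.
Variables (R : realType) (T T' : topologicalType) (A : set T) (f : T -> T').
Hypothesis cf : forall x, A x -> {for x, continuous f}.
Hypothesis injf : {in A &, injective f}.
Hypothesis openf : forall B, open B -> B `<=` A -> open (f @` B).
Hypothesis oA : open A.

Lemma is_path_image g x y :
  is_path A g x y -> is_path (R := R) (f @` A) (f \o g) (f x) (f y).
Proof.
move=> [cg gA g0 g1]; split; [|  | by rewrite /= g0|by rewrite /= g1].
  exact: within_continuous_comp_in cg gA cf.
by move=> _ [s Is <-]; exists (g s) => //; apply: gA; exists s.
Qed.

(** Openness of [f] on the open set [A] is exactly continuity of the inverse. *)
Lemma open_embedding_inverse : A !=set0 ->
  exists2 k : T' -> T, {in A, cancel f k} & forall y, (f @` A) y -> {for y, continuous k}.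
Proof.
move=> [x0 Ax0].
have H y : exists x, (f @` A) y -> A x /\ f x = y.
  have [[x Ax <-]|nAy] := pselect ((f @` A) y); first by exists x.
  by exists x0.
have [k Hk] := choice H.
have kK x : x \in A -> k (f x) = x.
  move=> xA; have Ax : A x by rewrite inE in xA.
  have [Ak fk] := Hk (f x) (ex_intro2 _ _ x Ax erefl).
  by apply: injf => //; rewrite inE.
exists k => // _ [x Ax <-].
rewrite /prop_for /continuous_at kK ?inE// => B.
rewrite nbhsE => -[V [oV Vx] VB] /=.
have oVA : open (V `&` A) by exact: openI.
have : nbhs (f x) (f @` (V `&` A)).
  apply: open_nbhs_nbhs; split; first by apply: openf => // z [].
  by exists x.
apply: filterS => _ [z [Vz Az] <-] /=.
by rewrite kK ?inE//; exact: VB.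
Qed.

(** A loop in the image is pulled back by the inverse, contracted in [A], and
    the contraction is pushed forward. *)
Lemma simply_connected_image :
  simply_connected R A -> simply_connected R (f @` A).
Proof.
move=> [pA sA]; split.
  move=> _ _ [x Ax <-] [y Ay <-].
  by have [g /is_path_image] := pA x y Ax Ay; exists (f \o g).
move=> g y [cg gA g0 g1].
have Ay : (f @` A) y.
  by apply: gA; exists 0 => //=; rewrite in_itv/= lexx ler01.
have [|k kK ck] := open_embedding_inverse.
  by have [x Ax _] := Ay; exists x.
have fkK z : (f @` A) z -> f (k z) = z.
  by move=> [x Ax <-]; rewrite kK ?inE.
have Ak z : (f @` A) z -> A (k z).
  by move=> [x Ax <-]; rewrite kK ?inE.
have kg : is_path A (k \o g) (k y) (k y).
  split; [|  |by rewrite /= g0|by rewrite /= g1].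
    exact: within_continuous_comp_in cg gA ck.
  by move=> _ [s Is <-]; apply: Ak; apply: gA; exists s.
have [H [cH HA H0 H1 H2]] := sA _ _ kg.
exists (f \o H); split.
- exact: within_continuous_comp_in cH HA cf.
- by move=> _ [s Is <-]; exists (H s) => //; apply: HA; exists s.
- move=> s sI; rewrite /= H0//= fkK//; apply: gA; exists s => //.
- by move=> s sI; rewrite /= H1// fkK.
- by move=> t tI; have [h0 h1] := H2 t tI; rewrite /= h0 h1 fkK.
Qed.

End open_embedding.

Lemma path_connected_connected (R : realType) (T : topologicalType) (A : set T) :
  path_connected R A -> connected A.
Proof.
move=> pA.
have [->|/set0P[x Ax]] := eqVneq A set0; first exact: connected0.
rewrite (_ : A = \bigcup_(B in [set B | connected B /\ B x /\ B `<=` A]) B); last first.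
  apply/seteqP; split; last by move=> z [B [_ [_ BA]] Bz]; exact: BA.
  move=> y Ay; have [g [cg gA g0 g1]] := pA x y Ax Ay.
  exists (g @` `[0, 1]); last by exists 1 => //=; rewrite in_itv/= lexx ler01.
  split; first by apply: connected_continuous_connected => //; exact: segment_connected.
  split => //; exists 0 => //=; rewrite in_itv/= lexx ler01.
  by [].
apply: bigcup_connected; last by move=> B [].
by exists x => B [_ []].
Qed.

Lemma simply_connected_connected (R : realType) (T : topologicalType) (A : set T) :
  simply_connected R A -> connected A.
Proof. by move=> [pA _]; exact: path_connected_connected pA. Qed.

(** Segments join points, and a loop contracts to its base point along them. *)
Lemma convex_simply_connected (R : realType) (V : normedModType R) (A : set V) :
  (forall x y t, A x -> A y -> 0 <= t <= 1 -> A ((1 - t) *: x + t *: y)) ->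
  simply_connected R A.
Proof.
move=> cA.
have cvgl (S : topologicalType) (F : set_system S) (FF : Filter F)
    (a b : S -> V) (c : S -> R) a0 b0 c0 :
  a @ F --> a0 -> b @ F --> b0 -> c @ F --> c0 ->
  (1 - c x) *: a x + c x *: b x @[x --> F] --> (1 - c0) *: a0 + c0 *: b0.
  move=> ha hb hc; apply: cvgD; last exact: cvgZ.
  by apply: cvgZ => //; apply: cvgB => //; exact: cvg_cst.
split.
  move=> x y Ax Ay; exists (fun t : R => (1 - t) *: x + t *: y); split.
  - apply: continuous_subspaceT => t; apply: cvgl;
      [exact: cvg_cst|exact: cvg_cst|exact: cvg_id].
  - by move=> _ [t It <-]; apply: cA => //; move: It; rewrite /= in_itv.
  - by rewrite subr0 scale1r scale0r addr0.
  - by rewrite subrr scale1r scale0r add0r.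
move=> g x [/subspace_continuousP cg gA g0 g1].
have Ax : A x by apply: gA; exists 0 => //=; rewrite in_itv/= lexx ler01.
exists (fun st : R * R => (1 - st.2) *: g st.1 + st.2 *: x); split.
- apply/subspace_continuousP => -[s t] [/= Is It]; apply: cvgl; last 2 first.
  + exact: cvg_cst.
  + have h : snd z @[z --> nbhs (s, t)] --> t by exact: cvg_snd.
    exact: cvg_within_filter h.
  apply: (@cvg_comp _ _ _ fst g _ (within `[0, 1] (nbhs s))); last exact: cg.
  (* the first projection sends points of the square near (s, t) to points of
     the interval near s *)
  move=> B; rewrite /within/= => wB.
  have h : fst z @[z --> nbhs (s, t)] --> s by exact: cvg_fst.
  have := h _ wB; rewrite /fmap/=.
  apply: (@filterS _ (nbhs (s, t))) => -[u v] /= huv [hu _].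
  exact: (huv hu).
- move=> _ [[s t] [/= Is It] <-]; apply: cA => //.
  by apply: gA; exists s.
- by move=> s _ /=; rewrite subr0 scale1r scale0r addr0.
- by move=> s _ /=; rewrite subrr scale1r scale0r add0r.
- by move=> t _ /=; rewrite g0 g1 -scalerDl subrK scale1r.
Qed.

(** * Area of shears *)

Section area.
Context {R : realType}.
Local Notation plane := (R * R)%type.
Local Notation mR := (measurableTypeR R).

Lemma lebesgue_measure_translation (a : R) (A : set R) : measurable A ->
  lebesgue_measure ((fun x => x + a) @^-1` A) = lebesgue_measure A.
Proof.
move=> mA.
have mf : measurable_fun [set: mR] ((fun x => x + a) : mR -> mR).
  by apply: measurable_funD => //; exact: measurable_cst.
apply/esym.
rewrite (lebesgue_measure_unique
  (mu := pushforward (@lebesgue_measure R) ((fun x => x + a) : mR -> mR)))//.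
move=> _ [[u v]] _ <- /=; rewrite /pushforward.
rewrite (_ : _ @^-1` _ = `]u - a, v - a]%classic); last first.
  by apply/seteqP; split => x /=; rewrite !in_itv/= ltrBlDr lerBrDr.
rewrite !lebesgue_measure_itv/= !lte_fin ltrD2r.
by case: ifP => // _; rewrite -!EFinB; congr EFin; ring.
Qed.

(** The product sigma-algebra is generated by the two coordinates, whose
    preimages of intervals are open, hence measurable. *)
Lemma continuous_measurable_plane (f : plane -> plane) : continuous f ->
  measurable_fun [set: (mR * mR)%type] (f : (mR * mR)%type -> (mR * mR)%type).
Proof.
move=> cf.
have mf (h : plane -> R) : continuous h ->
    measurable_fun [set: (mR * mR)%type] (h : (mR * mR)%type -> mR).
  move=> ch; apply: (@measurability _ _ _ _ setT _ (@RGenOpens.G R)).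
    exact: (RGenOpens.measurableE R).
  move=> _ [_ [a [b ->]] <-]; rewrite setTI; apply: open_measurable_plane.
  by move/continuousP : ch; apply; exact: interval_open.
apply/measurable_fun_pairP; split; apply: mf => x.
  exact: (continuous_comp (cf x) (@cvg_fst _ _ _ _ _)).
exact: (continuous_comp (cf x) (@cvg_snd _ _ _ _ _)).
Qed.

Lemma continuous_pair (u v : plane -> R) : continuous u -> continuous v ->
  continuous (fun x => (u x, v x)).
Proof. by move=> cu cv x; exact: (cvg_pair (cu x) (cv x)). Qed.

Lemma continuous_fst_plane : continuous (fst : plane -> R).
Proof. by move=> x; exact: cvg_fst. Qed.

Lemma continuous_snd_plane : continuous (snd : plane -> R).
Proof. by move=> x; exact: cvg_snd. Qed.

Definition vshear (g : R -> R) (x : plane) : plane := (x.1, x.2 + g x.1).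
Definition hshear (f : R -> R) (x : plane) : plane := (x.1 + f x.2, x.2).

Lemma continuous_vshear g : continuous g -> continuous (vshear g).
Proof.
move=> cg; apply: continuous_pair => x; first exact: continuous_fst_plane.
apply: cvgD; first exact: continuous_snd_plane.
by apply: (@continuous_comp _ _ _ fst g x); [exact: continuous_fst_plane|exact: cg].
Qed.

Lemma continuous_hshear f : continuous f -> continuous (hshear f).
Proof.
move=> cf; apply: continuous_pair => x; last exact: continuous_snd_plane.
apply: cvgD; first exact: continuous_fst_plane.
by apply: (@continuous_comp _ _ _ snd f x); [exact: continuous_snd_plane|exact: cf].
Qed.

(** Fubini: the shear only translates each vertical section. *)
Lemma lebesgue_plane_vshear g (A : set plane) : measurable A ->
  lebesgue_plane (vshear g @^-1` A) = lebesgue_plane A.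
Proof.
move=> mA; apply: eq_integral => x _ /=.
rewrite (_ : xsection (vshear g @^-1` A) x = (fun y => y + g x) @^-1` xsection A x).
  by apply: lebesgue_measure_translation; exact: measurable_xsection.
by apply/seteqP; split => y; rewrite /xsection/= !inE.
Qed.

(** Integrating over the other variable gives the same measure, which lets the
    horizontal sections be used as well. *)
Lemma lebesgue_planeE (A : set plane) : measurable A ->
  lebesgue_plane A = (@lebesgue_measure R \x^ @lebesgue_measure R)%E A.
Proof.
move=> mA; apply: product_measure_unique => // B C mB mC.
exact: product_measure2E.
Qed.

Lemma lebesgue_plane_hshear f (A : set plane) : continuous f -> measurable A ->
  lebesgue_plane (hshear f @^-1` A) = lebesgue_plane A.
Proof.
move=> cf mA.
have mp : measurable (hshear f @^-1` A).
  rewrite -[X in measurable X]setTI.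
  exact: (continuous_measurable_plane (continuous_hshear cf) measurableT mA).
rewrite !lebesgue_planeE//; apply: eq_integral => y _ /=.
rewrite (_ : ysection (hshear f @^-1` A) y = (fun x => x + f y) @^-1` ysection A y).
  by apply: lebesgue_measure_translation; exact: measurable_ysection.
by apply/seteqP; split => x; rewrite /ysection/= !inE.
Qed.

End area.

(** * The torus and the unit square *)

Section torus_projection.
Context {R : realType}.
Local Notation plane := (R * R)%type.

Lemma torus_projP (x y : plane) :
  torus_proj x = torus_proj y <-> exists k, y = x + lattice_point k.
Proof.
split=> [/eqquotP/asboolP//|h].
by apply/eqquotP/asboolP.
Qed.

Lemma continuous_torus_proj : continuous (@torus_proj R).
Proof. exact: pi_continuous. Qed.

(** The saturation of an open set is a union of its integer translates. *)
Lemma open_torus_proj (B : set plane) : open B -> open (torus_proj @` B).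
Proof.
move=> oB.
have : open (torus_proj @^-1` (torus_proj @` B)); last by [].
rewrite (_ : _ @^-1` _ = \bigcup_k (fun x => x + lattice_point k) @^-1` B).
  apply: bigcup_open => k _.
  apply: open_comp => // x _.
  by apply: cvgD; [exact: cvg_id|exact: cvg_cst].
apply/seteqP; split => x /=.
  by move=> [y By /esym /torus_projP[k yE]]; exists k => //=; rewrite -yE.
move=> [k _ Bk]; exists (x + lattice_point k) => //.
by apply/esym/torus_projP; exists k.
Qed.

Definition open_unit_square : set plane := `]0, 1[ `*` `]0, 1[.

Lemma open_open_unit_square : open open_unit_square.
Proof.
rewrite (_ : open_unit_square = fst @^-1` `]0, 1[ `&` snd @^-1` `]0, 1[)//.
apply: openI; apply: open_comp => [x _|]; try exact: interval_open.
  exact: continuous_fst_plane.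
exact: continuous_snd_plane.
Qed.

Lemma simply_connected_open_unit_square : simply_connected R open_unit_square.
Proof.
have cvx (a b t : R) : 0 < a < 1 -> 0 < b < 1 -> 0 <= t <= 1 ->
    0 < (1 - t) * a + t * b < 1.
  move=> /andP[a0 a1] /andP[b0 b1] /andP[t0 t1].
  have [->|tn0] := eqVneq t 0.
    by rewrite subr0 mul1r mul0r addr0 a0.
  have {tn0} : 0 < t by rewrite lt_neqAle eq_sym tn0.
  by move=> {}t0; apply/andP; split; nra.
apply: convex_simply_connected => -[x1 x2] [y1 y2] t [/=].
rewrite !in_itv/= => hx1 hx2 [/=]; rewrite !in_itv/= => hy1 hy2 ht.
split => /=; rewrite in_itv/=; exact: cvx.
Qed.

Lemma open_unit_square_lattice (x y : plane) k :
  open_unit_square x -> open_unit_square y ->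
  y = x + lattice_point k -> k = 0.
Proof.
move: x y k => [x1 x2] [y1 y2] [k1 k2] [/=].
rewrite !in_itv/= => hx1 hx2 [/=]; rewrite !in_itv/= => hy1 hy2 [h1 h2].
have aux (a b : R) (k : int) : 0 < a < 1 -> 0 < b < 1 -> b = a + k%:~R -> k = 0.
  move=> /andP[a0 a1] /andP[b0 b1] hab.
  have kl1 : (k < 1)%R by rewrite -(ltr_int R); lra.
  have kg1 : (- 1 < k)%R by rewrite -(ltr_int R); lra.
  lia.
by rewrite (aux _ _ k1 hx1 hy1 h1) (aux _ _ k2 hx2 hy2 h2).
Qed.

(** The lines with an integer coordinate: what the integer translates of the
    open unit square leave uncovered. *)
Definition grid : set plane := (range intr `*` setT) `|` (setT `*` range intr).

Lemma lattice_translate_unit_square (x : plane) : ~ grid x ->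
  exists k, open_unit_square (x + lattice_point k).
Proof.
move: x => [x1 x2] /not_orP[/= h1 h2].
have aux (a : R) : ~ (range intr a) -> 0 < a + (- Num.floor a)%:~R < 1.
  move=> ha; have /andP[l u] := floor_itv a.
  rewrite intrN; rewrite intrD in u.
  have ne : (Num.floor a)%:~R != a by apply/eqP => e; apply: ha; exists (Num.floor a).
  move: l; rewrite le_eqVlt (negbTE ne)/= => l.
  by apply/andP; split; lra.
exists (- Num.floor x1, - Num.floor x2); split; rewrite /= in_itv /=; apply: aux => h.
  by apply: h1.
by apply: h2.
Qed.

Let cI : countable (range intr : set R).
Proof. exact: card_le_trans (card_image_le _ _) (countableP _). Qed.

Let mI : measurable (range intr : set (measurableTypeR R)).
Proof. exact: countable_measurable. Qed.

Lemma measurable_grid : measurable grid.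
Proof. by apply: measurableU; apply: measurableX. Qed.

Lemma lebesgue_plane_grid : lebesgue_plane grid = 0%E.
Proof.
have I0 : lebesgue_measure (range intr : set (measurableTypeR R)) = 0%E.
  exact: countable_lebesgue_measure0.
have planeX (A B : set (measurableTypeR R)) : measurable A -> measurable B ->
    (lebesgue_plane (A `*` B) = lebesgue_measure A * lebesgue_measure B)%E.
  by move=> mA mB; rewrite /lebesgue_plane product_measure1E.
apply/eqP; rewrite eq_le measure_ge0 andbT.
apply: le_trans (measureU2 _ _ _) _; try exact: measurableX.
by rewrite [X in (X + _)%E]planeX// [X in (_ + X)%E]planeX// !I0 mul0e mule0 adde0.
Qed.

End torus_projection.

(** * Area-preserving lifts of torus homeomorphisms *)

Section toral_homeomorphisms.
Context {R : realType}.
Local Notation plane := (R * R)%type.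

(** The inverse is carried along as a parameter: it turns images into preimages,
    for which openness and measurability are immediate.  Normalising [H 0 = 0]
    makes [H] fix the whole lattice by equivariance. *)
Record toral_homeo (H K : plane -> plane) : Prop := ToralHomeo {
  toral_continuous : continuous H;
  toral_continuousV : continuous K;
  toralK : cancel H K;
  toralVK : cancel K H;
  toral_lattice : forall x k, H (x + lattice_point k) = H x + lattice_point k;
  toral0 : H 0 = 0;
  toral_area : forall A, measurable A -> lebesgue_plane (K @^-1` A) = lebesgue_plane A }.

Lemma toral_homeo_id : toral_homeo id id.
Proof. by split => // x; exact: cvg_id. Qed.

Lemma measurable_toral_preimage H K (A : set plane) : toral_homeo H K ->
  measurable A -> measurable (K @^-1` A).
Proof.
move=> hHK mA; rewrite -[X in measurable X]setTI.
exact: (continuous_measurable_plane (toral_continuousV hHK) measurableT mA).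
Qed.

Lemma toral_homeo_comp H K H' K' : toral_homeo H K -> toral_homeo H' K' ->
  toral_homeo (H \o H') (K' \o K).
Proof.
move=> h h'; split.
- move=> x; apply: continuous_comp; first exact: (toral_continuous h').
  exact: (toral_continuous h).
- move=> x; apply: continuous_comp; first exact: (toral_continuousV h).
  exact: (toral_continuousV h').
- by apply: can_comp; [exact: toralK h|exact: toralK h'].
- by apply: can_comp; [exact: toralVK h'|exact: toralVK h].
- by move=> x k /=; rewrite (toral_lattice h') (toral_lattice h).
- by rewrite /= (toral0 h') (toral0 h).
- move=> A mA; rewrite comp_preimage (toral_area h) ?(toral_area h')//.
  exact: measurable_toral_preimage h' mA.
Qed.

Lemma toral_homeo_vshear (g : R -> R) :
  continuous g -> (forall (x : R) (k : int), g (x + k%:~R) = g x) ->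
  g 0 = 0 -> toral_homeo (vshear g) (vshear (fun x => - g x)).
Proof.
move=> cg pg g0; have cNg : continuous (fun x => - g x).
  by move=> x; apply: cvgN; exact: cg.
split.
- exact: continuous_vshear.
- exact: continuous_vshear.
- by move=> [x y]; rewrite /vshear/= addrK.
- by move=> [x y]; rewrite /vshear/= subrK.
- by move=> [x y] k; rewrite /vshear/= pg; congr pair => /=; rewrite addrAC.
- by rewrite /vshear/= g0 addr0.
- by move=> A mA; exact: lebesgue_plane_vshear.
Qed.

Lemma toral_homeo_hshear (f : R -> R) :
  continuous f -> (forall (x : R) (k : int), f (x + k%:~R) = f x) ->
  f 0 = 0 -> toral_homeo (hshear f) (hshear (fun x => - f x)).
Proof.
move=> cf pf f0; have cNf : continuous (fun x => - f x).
  by move=> x; apply: cvgN; exact: cf.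
split.
- exact: continuous_hshear.
- exact: continuous_hshear.
- by move=> [x y]; rewrite /hshear/= addrK.
- by move=> [x y]; rewrite /hshear/= subrK.
- by move=> [x y] k; rewrite /hshear/= pf; congr pair => /=; rewrite addrAC.
- by rewrite /hshear/= f0 addr0.
- by move=> A mA; exact: lebesgue_plane_hshear.
Qed.

Lemma toral_homeo_lattice_point H K k :
  toral_homeo H K -> H (lattice_point k) = lattice_point k.
Proof.
move=> h; rewrite -[in LHS](add0r (lattice_point k)).
by rewrite (toral_lattice h) (toral0 h) add0r.
Qed.

Lemma open_toral_image H K (B : set plane) : toral_homeo H K -> open B -> open (H @` B).
Proof.
move=> h oB; rewrite (_ : H @` B = K @^-1` B).
  by apply: open_comp => // x _; exact: (toral_continuousV h).
apply/seteqP; split => x /=; first by move=> [y By <-]; rewrite (toralK h).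
by move=> BK; exists (K x) => //; rewrite (toralVK h).
Qed.

Lemma measurable_open_torus (V : set (torus R)) : open V -> measurable V.
Proof. by move=> oV; apply: sub_sigma_algebra. Qed.

(** A point of the torus outside the image lifts to a point of [H @` grid], by
    equivariance of [H]; that set is null because [H] preserves area. *)
Lemma lebesgue_torus_toral_square H K : toral_homeo H K ->
  lebesgue_torus (torus_proj @` (H @` open_unit_square)) = 1%E.
Proof.
move=> h; set U := torus_proj @` _.
have oU : open U.
  by apply: open_torus_proj; apply: (open_toral_image h); exact: open_open_unit_square.
have mU := measurable_open_torus oU.
suff CU0 : lebesgue_torus (~` U) = 0%E.
  have mCU := measurableC mU.
  have := probability_setC lebesgue_torus mCU; rewrite setCK => ->.
  by rewrite [X in (1 - X)%E]CU0 sube0.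
have mCU : measurable (torus_proj @^-1` (~` U) `&` fundamental_domain (R := R)).
  apply: measurableI; last exact: measurable_fundamental_domain.
  rewrite -[X in measurable X]setTI; apply: measurable_torus_proj => //.
  exact: measurableC.
have mg := measurable_toral_preimage h measurable_grid.
apply/eqP; rewrite eq_le measure_ge0 andbT.
rewrite -lebesgue_plane_grid -(toral_area h measurable_grid).
suff : (lebesgue_plane (torus_proj @^-1` (~` U) `&` fundamental_domain (R := R))
    <= lebesgue_plane (K @^-1` grid))%E by [].
apply: (le_measure (@lebesgue_plane R)); [by rewrite inE|by rewrite inE|].
move=> x [/= nUx _]; apply: contrapT => /lattice_translate_unit_square[k Kx].
apply: nUx; exists (H (K x + lattice_point k)); first by exists (K x + lattice_point k).
rewrite (toral_lattice h) (toralVK h).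
by apply/esym/torus_projP; exists k.
Qed.

End toral_homeomorphisms.

(** * Shears supported near the grid *)

Section step.
Context {R : realType}.
Local Notation plane := (R * R)%type.

(** A continuous 1-periodic substitute for the distance to the nearest
    integer. *)
Definition periodic_gap (x : R) : R := sin (pi * x) ^+ 2.
Local Notation gap := periodic_gap.

Lemma gap_ge0 x : 0 <= gap x.
Proof. exact: sqr_ge0. Qed.

Lemma gap0 : gap 0 = 0.
Proof. by rewrite /gap mulr0 sin0 expr0n. Qed.

Lemma gapD1 x : gap (x + 1) = gap x.
Proof. by rewrite /gap mulrDr mulr1 sinDpi sqrrN. Qed.

Lemma gap_periodic x (k : int) : gap (x + k%:~R) = gap x.
Proof.
have gapn (n : nat) y : gap (y + n%:R) = gap y.
  by elim: n y => [|n IH] y; rewrite ?addr0// -addn1 natrD addrA gapD1 IH.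
case: k => n; first exact: gapn.
by have := gapn n.+1 (x - n.+1%:R); rewrite subrK NegzE intrN => ->.
Qed.

Lemma gap_gt0 x : 0 < x < 1 -> 0 < gap x.
Proof.
move=> /andP[x0 x1]; apply: exprn_gt0; apply: sin_gt0_pi.
by rewrite mulr_gt0 ?pi_gt0//= -[ltRHS]mulr1 ltr_pM2l ?pi_gt0.
Qed.

Lemma continuous_gap : continuous gap.
Proof.
move=> x; apply: (continuous_comp (f := fun x => sin (pi * x))
  (g := fun y : R => y ^+ 2)); last exact: exprn_continuous.
apply: continuous_comp; last exact: continuous_sin.
by apply: cvgM; [exact: cvg_cst|exact: cvg_id].
Qed.

Lemma gap_eq0D x t : gap x = 0 -> 0 < t < 1 -> 0 < gap (x + t).
Proof.
move=> /eqP; rewrite /gap sqrf_eq0 => /eqP sx0 t01.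
rewrite mulrDr sinD sx0 mul0r add0r exprMn mulr_gt0//; last exact: gap_gt0.
by have := cos2Dsin2 (pi * x); rewrite sx0 expr0n addr0 => ->.
Qed.

(** The first factor makes it vanish away from the integers, so that shears
    leave the core alone; the second one makes it vanish at the integers, so
    that shears fix the lattice. *)
Definition bump (eta x : R) : R := Num.max 0 (eta - gap x) * gap x.

Lemma continuous_bump eta : continuous (bump eta).
Proof.
move=> x; apply: cvgM; last exact: continuous_gap.
apply: (@continuous_max _ _ (fun=> 0) (fun x => eta - gap x)); first exact: cvg_cst.
by apply: cvgB; [exact: cvg_cst|exact: continuous_gap].
Qed.

Lemma bump_periodic eta x (k : int) : bump eta (x + k%:~R) = bump eta x.
Proof. by rewrite /bump gap_periodic. Qed.

Lemma bump0 eta : bump eta 0 = 0.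
Proof. by rewrite /bump gap0 mulr0. Qed.

Lemma bump_eq0 eta x : eta < gap x -> bump eta x = 0.
Proof. by move=> h; rewrite /bump max_l ?mul0r// subr_le0 ltW. Qed.

Lemma bump_gt0 eta x : 0 < gap x < eta -> 0 < bump eta x.
Proof.
move=> /andP[g0 ge]; rewrite /bump max_r; first by rewrite mulr_gt0// subr_gt0.
by rewrite subr_ge0 ltW.
Qed.

(** The protected part of the unit square: shears with profile [bump eta] are
    the identity on it. *)
Definition core (eta : R) : set plane :=
  open_unit_square `&` [set x | eta < gap x.1 /\ eta < gap x.2].

Lemma open_core eta : open (core eta).
Proof.
have og : open [set t | eta < gap t].
  rewrite (_ : [set t | _] = gap @^-1` `]eta, +oo[); last first.
    by apply/seteqP; split => t /=; rewrite in_itv/= andbT.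
  by apply: open_comp => [x _|]; [exact: continuous_gap|exact: interval_open].
apply: openI; first exact: open_open_unit_square.
rewrite (_ : [set x | _] = fst @^-1` [set t | eta < gap t] `&`
  snd @^-1` [set t | eta < gap t])//.
apply: openI; apply: open_comp => // x _.
  exact: continuous_fst_plane.
exact: continuous_snd_plane.
Qed.

Lemma subset_core eta eta' : eta <= eta' -> core eta' `<=` core eta.
Proof. by move=> e x [? [? ?]]; split => //; split; exact: le_lt_trans e _. Qed.

Lemma bigcup_core : \bigcup_n core n.+1%:R^-1 = open_unit_square.
Proof.
apply/seteqP; split => [x [n _] []//|x sx].
have [] : 0 < gap x.1 /\ 0 < gap x.2.
  by case: sx => /=; rewrite !in_itv/= => h1 h2; split; exact: gap_gt0.
move=> g1 g2.
have [n _ hn] : \forall n \near \oo, n.+1%:R^-1 < gap x.1 /\ n.+1%:R^-1 < gap x.2.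
  near=> n; split; near: n.
    exact: (near_infty_natSinv_lt (PosNum g1)).
  exact: (near_infty_natSinv_lt (PosNum g2)).
exists n => //; split => //=; apply: hn; exact: leqnn.
Unshelve. all: by end_near. Qed.

(** Continuity from below, the cores exhausting the open unit square. *)
Lemma lebesgue_torus_core_cvg H K : toral_homeo H K ->
  lebesgue_torus (torus_proj @` (H @` core n.+1%:R^-1)) @[n --> \oo] --> 1%E.
Proof.
move=> h; rewrite -(lebesgue_torus_toral_square h) -bigcup_core !image_bigcup.
have mC (n : nat) : measurable (torus_proj @` (H @` core n.+1%:R^-1)).
  by apply: measurable_open_torus; apply: open_torus_proj;
    apply: (open_toral_image h); exact: open_core.
apply: (nondecreasing_cvg_mu (mu := @lebesgue_torus R)) => //.
  exact: bigcupT_measurable.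
move=> m n mn; apply/subsetPset; apply: image_subset; apply: image_subset.
by apply: subset_core; rewrite lef_pV2 ?posrE// ler_nat.
Qed.

Definition corner_box (k : int * int) (e : R) : set plane :=
  [set z | k.1%:~R < z.1 < k.1%:~R + e /\ k.2%:~R < z.2 < k.2%:~R + e].

Lemma open_corner_box k e : open (corner_box k e).
Proof.
rewrite (_ : corner_box k e = fst @^-1` `]k.1%:~R, k.1%:~R + e[ `&`
   snd @^-1` `]k.2%:~R, k.2%:~R + e[); last first.
  by apply/seteqP; split => z /=; rewrite !in_itv.
apply: openI; apply: open_comp => [x _|]; try exact: interval_open.
  exact: continuous_fst_plane.
exact: continuous_snd_plane.
Qed.

(** Close to the lattice point [k], fixed by [H], there are points sent into the
    corner box; the abscissa of one of them can be perturbed to a non-integer,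
    so that a shear with profile [bump eta] is able to move it. *)
Lemma exists_corner_preimage H K eta k e : toral_homeo H K -> 0 < eta -> 0 < e ->
  exists w : plane, corner_box k e (H w) /\ 0 < gap w.1 < eta.
Proof.
move=> h eta0 e0.
have oV : open [set w : plane | gap w.1 < eta].
  rewrite (_ : [set w : plane | _] = (gap \o fst) @^-1` `]-oo, eta[); last first.
    by apply/seteqP; split => t /=; rewrite in_itv.
  apply: open_comp => [x _|]; last exact: interval_open.
  by apply: continuous_comp; [exact: continuous_fst_plane|exact: continuous_gap].
pose V := [set w : plane | gap w.1 < eta] `&` H @^-1` corner_box k e.
have oVH : open V.
  apply: openI => //; apply: open_comp; last exact: open_corner_box.
  by move=> x _; exact: (toral_continuous h).
have [w0 Vw0] : V !=set0.
  have : nbhs (lattice_point k : plane) (H @` [set w : plane | gap w.1 < eta]).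
    apply: open_nbhs_nbhs; split; first exact: (open_toral_image h).
    exists (lattice_point k); last exact: toral_homeo_lattice_point h.
    by rewrite /= -[_%:~R]add0r gap_periodic gap0.
  move=> /nbhs_ballP[d /= d0 dV].
  pose r := Num.min d e / 2.
  have m0 : 0 < Num.min d e by rewrite lt_min d0 e0.
  have md : Num.min d e <= d by rewrite ge_min lexx.
  have me : Num.min d e <= e by rewrite ge_min lexx orbT.
  have [|w Vw Hw] := dV (k.1%:~R + r, k.2%:~R + r).
    by split; rewrite /ball/= opprD addNKr normrN gtr0_norm /r; lra.
  exists w; split => //=; rewrite Hw; split => /=; rewrite /r; apply/andP; split; lra.
(* an integer abscissa is shifted to the right by less than 1 *)
have [g0|g0] := ltP 0 (gap w0.1).
  by exists w0; case: Vw0 => /= v1 v2; rewrite g0 v1.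
have {}g0 : gap w0.1 = 0 by apply/eqP; rewrite eq_le g0 gap_ge0.
have /nbhs_ballP[d /= d0 dV] : nbhs w0 V by exact: open_nbhs_nbhs.
pose t := Num.min d 1 / 2.
have m0 : 0 < Num.min d 1 by rewrite lt_min d0 ltr01.
have md : Num.min d 1 <= d by rewrite ge_min lexx.
have m1 : Num.min d 1 <= 1 by rewrite ge_min lexx orbT.
exists (w0.1 + t, w0.2).
have [|v1 v2] := dV (w0.1 + t, w0.2).
  split; last exact: ballxx.
  by rewrite /ball/= opprD addNKr normrN gtr0_norm /t; lra.
split => //=; rewrite v1 andbT; apply: gap_eq0D => //.
by rewrite /t; apply/andP; split; lra.
Qed.

End step.

(** * The tower of homeomorphisms *)

Section tower.
Context {R : realType}.
Local Notation plane := (R * R)%type.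
Local Notation gap := (@periodic_gap R).

Definition core_area (H : plane -> plane) (eta : R) : \bar R :=
  lebesgue_torus (torus_proj @` (H @` core eta)).

Lemma exists_unit_gap_lt (eta : R) : 0 < eta -> exists2 t : R, 0 < t < 1 & gap t < eta.
Proof.
move=> eta0; have := @continuous_gap R 0; rewrite /continuous_at gap0.
move=> /cvgrPdist_lt/(_ _ eta0)/nbhs_ballP[d /= d0 dV].
have m0 : 0 < Num.min d 1 by rewrite lt_min d0 ltr01.
have md : Num.min d 1 <= d by rewrite ge_min lexx.
have m1 : Num.min d 1 <= 1 by rewrite ge_min lexx orbT.
exists (Num.min d 1 / 2); first by apply/andP; split; lra.
have := dV (Num.min d 1 / 2); rewrite /ball/= !sub0r !normrN gtr0_norm; last by lra.
by rewrite ger0_norm ?gap_ge0//; apply; lra.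
Qed.

(** With [w] as in [exists_corner_preimage] and [y] close to 0, the point
    [(2^-1, y)] is moved horizontally to [(w.1, y)] and then vertically to [w].
    The horizontal shear can have any amplitude at height [y], and the vertical
    one any amplitude at abscissa [w.1]. *)
Lemma toral_move_core H K eta k e : toral_homeo H K -> 0 < eta -> 0 < e ->
  exists H' K' : plane -> plane,
    [/\ toral_homeo H' K', forall x, core eta x -> H' x = H x &
    exists p, open_unit_square p /\ corner_box k e (H' p)].
Proof.
move=> h eta0 e0.
have [w [Hw gw]] := exists_corner_preimage k h eta0 e0.
have [y y01 gy] := exists_unit_gap_lt eta0.
have by0 : 0 < bump eta y by apply: bump_gt0; rewrite gap_gt0.
have bw0 := bump_gt0 gw.
pose shear_by (a x : R) := a * bump eta x.
have cs a : continuous (shear_by a).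
  by move=> x; apply: cvgM; [exact: cvg_cst|exact: continuous_bump].
have ps a (x : R) (j : int) : shear_by a (x + j%:~R) = shear_by a x.
  by rewrite /shear_by bump_periodic.
have s0 a : shear_by a 0 = 0 by rewrite /shear_by bump0 mulr0.
pose f := shear_by ((w.1 - 2^-1) / bump eta y).
pose g := shear_by ((w.2 - y) / bump eta w.1).
have hf : toral_homeo (hshear f) (hshear (fun x => - f x)).
  by exact: toral_homeo_hshear (cs _) (ps _) (s0 _).
have hg : toral_homeo (vshear g) (vshear (fun x => - g x)).
  by exact: toral_homeo_vshear (cs _) (ps _) (s0 _).
have := toral_homeo_comp h (toral_homeo_comp hg hf).
set H' := H \o _; set K' := _ \o K => h'; exists H', K'; split => //.
  move=> x [_ [/= g1 g2]]; rewrite /H'/= /hshear /vshear/=.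
  rewrite /f /g /shear_by (bump_eq0 g2) mulr0 addr0 (bump_eq0 g1) mulr0 addr0.
  by rewrite -surjective_pairing.
exists (2^-1, y); split.
  by split; rewrite /= in_itv//=; apply/andP; split; lra.
rewrite /H'/= /hshear/= /f /shear_by divfK ?gt_eqF//.
rewrite addrCA subrr addr0 /vshear/= /g /shear_by divfK ?gt_eqF//.
by rewrite addrCA subrr addr0 -surjective_pairing.
Qed.

Lemma toral_step H K eta k e : toral_homeo H K -> 0 < eta -> 0 < e ->
  exists (H' K' : plane -> plane) (eta' : R),
    [/\ toral_homeo H' K' /\ 0 < eta', eta' <= eta /\ eta' <= e,
    forall x, core eta x -> H' x = H x,
    exists p, core eta' p /\ corner_box k e (H' p) &
    ((1 - e)%:E <= core_area H' eta')%E].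
Proof.
move=> h eta0 e0.
have [H' [K' [h' HH' [p [sp cp]]]]] := toral_move_core k h eta0 e0.
(* all the constraints on eta' hold for eta' = 1 / (n + 1) and n large *)
exists H', K'.
have : \forall n \near \oo, [/\ n.+1%:R^-1 < eta, n.+1%:R^-1 < e,
    core n.+1%:R^-1 p & ((1 - e)%:E <= core_area H' n.+1%:R^-1)%E].
  have [g1 g2] : 0 < gap p.1 /\ 0 < gap p.2.
    by case: sp => /=; rewrite !in_itv/= => ? ?; split; exact: gap_gt0.
  have area_large : \forall n \near \oo, ((1 - e)%:E <= core_area H' n.+1%:R^-1)%E.
    have near1 : \forall y \near 1%E, ((1 - e)%:E < y)%E.
      by apply: open_ereal_gt'; rewrite lte_fin ltrBlDr ltrDl.
    near=> n; apply: ltW; near: n.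
    exact: (lebesgue_torus_core_cvg h' near1).
  near=> n; split; near: n.
  - exact: (near_infty_natSinv_lt (PosNum eta0)).
  - exact: (near_infty_natSinv_lt (PosNum e0)).
  - near=> n; split => //; split => /=; near: n.
      exact: (near_infty_natSinv_lt (PosNum g1)).
    exact: (near_infty_natSinv_lt (PosNum g2)).
  - exact: area_large.
move=> [n _ /(_ n (leqnn n))[n1 n2 n3 n4]].
exists n.+1%:R^-1; split => //; last by exists p.
  by split; exact: ltW.
Unshelve. all: by end_near. Qed.

(** The state of the recursion in [toral_tower], bundled with its invariant so
    that the choice of the next stage is a plain function. *)
Record stage := Stage {
  stage_map : plane -> plane;
  stage_inv : plane -> plane;
  stage_width : R;
  stageP : toral_homeo stage_map stage_inv /\ 0 < stage_width }.

Lemma toral_tower (tgt : nat -> int * int) (e : nat -> R) : (forall n, 0 < e n) ->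
  exists (H K : nat -> plane -> plane) (eta : nat -> R), [/\
    forall n, toral_homeo (H n) (K n) /\ 0 < eta n,
    forall n, eta n.+1 <= eta n /\ eta n.+1 <= e n,
    forall n x, core (eta n) x -> H n.+1 x = H n x,
    forall n, exists p, core (eta n.+1) p /\ corner_box (tgt n) (e n) (H n.+1 p) &
    forall n, ((1 - e n)%:E <= core_area (H n.+1) (eta n.+1))%E].
Proof.
move=> e0.
have nxt (ns : nat * stage) : exists s' : stage, let: (n, s) := ns in
  [/\ stage_width s' <= stage_width s /\ stage_width s' <= e n,
   forall x, core (stage_width s) x -> stage_map s' x = stage_map s x,
   exists p, core (stage_width s') p /\ corner_box (tgt n) (e n) (stage_map s' p) &
   ((1 - e n)%:E <= core_area (stage_map s') (stage_width s'))%E].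
  case: ns => n [H K eta [h eta0]].
  have [H' [K' [eta' [[h' eta'0] ee HH' cp a]]]] := toral_step (tgt n) h eta0 (e0 n).
  by exists (Stage (conj h' eta'0)).
have [next nextP] := choice nxt.
pose fix s n := if n is m.+1 then next (m, s m) 
  else Stage (conj (@toral_homeo_id R) (@ltr01 R)).
exists (fun n => stage_map (s n)), (fun n => stage_inv (s n)),
  (fun n => stage_width (s n)).
split=> n; first exact: stageP.
- by case: (nextP (n, s n)).
- by case: (nextP (n, s n)).
- by case: (nextP (n, s n)).
- by case: (nextP (n, s n)).
Qed.

End tower.

(** * Directions at infinity *)

Section directions.
Context {R : realType}.
Local Notation plane := (R * R)%type.

Lemma euclidean_normZ (a : R) (x : plane) : 0 <= a ->
  euclidean_norm (a *: x) = a * euclidean_norm x.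
Proof.
move=> a0; rewrite /euclidean_norm/= !exprMn -mulrDr sqrtrM ?sqr_ge0//.
by rewrite sqrtr_sqr ger0_norm.
Qed.

Lemma continuous_euclidean_norm : continuous (@euclidean_norm R).
Proof.
have csq (h : plane -> R) : continuous h -> continuous (fun x => h x ^+ 2).
  move=> ch x.
  apply: (continuous_comp (f := h) (g := fun y : R => y ^+ 2)); first exact: ch.
  exact: exprn_continuous.
move=> x; apply: (continuous_comp (f := fun x : plane => x.1 ^+ 2 + x.2 ^+ 2)
  (g := @Num.sqrt R)).
  by apply: cvgD; apply: csq; [exact: continuous_fst_plane|exact: continuous_snd_plane].
exact: sqrt_continuous.
Qed.

Lemma cvg_bounded_perturbation (v : plane) (r : nat -> plane) (C : R) :
  (forall n, `|r n| <= C) -> v + n.+1%:R^-1 *: r n @[n --> \oo] --> v.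
Proof.
move=> rC; rewrite -[X in _ --> X]addr0; apply: cvgD; first exact: cvg_cst.
apply/norm_cvg0P.
apply: (@squeeze_cvgr _ _ _ _ (fun=> 0) (fun n => n.+1%:R^-1 * C)).
- apply: nearW => n; rewrite normr_ge0 normrZ ger0_norm ?invr_ge0//=.
  by rewrite ler_wpM2l ?invr_ge0.
- exact: cvg_cst.
- rewrite -[X in _ --> X](mul0r C); apply: cvgM; last exact: cvg_cst.
  exact: cvg_harmonic.
Qed.

(** Choose the n-th point in the unit square based at [(n + 1) v].  Both it and
    its difference with the first one are [(n + 1) (v + o(1))]. *)
Lemma meets_squares_clusters (A : set plane) (v : plane) :
  (forall w, A `&` translate w (@unit_square R) !=set0) -> unit_circle v ->
  clusters_in_direction A v.
Proof.
move=> hA v1.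
have /choice[x xP] : forall n : nat,
    exists x, A x /\ translate (n.+1%:R *: v) (@unit_square R) x.
  by move=> n; have [x Ax] := hA (n.+1%:R *: v); exists x.
have xE n : exists2 s : plane, `|s| <= 1 & x n = s + n.+1%:R *: v.
  have [_ [[s1 s2] [/=]]] := xP n; rewrite !in_itv/= => h1 h2 <-.
  exists (s1, s2) => //; rewrite prod_normE ge_max/=.
  by case/andP: h1 => ? s1le; case/andP: h2 => ? s2le; rewrite !ger0_norm// s1le.
have nE n (y : plane) : n.+1%:R *: (v + n.+1%:R^-1 *: y) = y + n.+1%:R *: v.
  by rewrite scalerDr scalerA mulfV ?pnatr_eq0// scale1r addrC.
have normx (y : nat -> plane) (C : R) :
   (forall n, exists2 s : plane, `|s| <= C & y n = s + n.+1%:R *: v) ->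
   exists2 q : nat -> plane, q n @[n --> \oo] --> v & forall n, y n = n.+1%:R *: q n.
  move=> h; have /choice[s sP] : forall n,
      exists s : plane, `|s| <= C /\ y n = s + n.+1%:R *: v.
    by move=> n; have [s] := h n; exists s.
  exists (fun n => v + n.+1%:R^-1 *: s n) => [|n].
    by apply: (@cvg_bounded_perturbation v s C) => n; case: (sP n).
  by rewrite nE; case: (sP n).
have [q qv qE] := normx _ _ xE.
have [q' qv' qE'] : exists2 q : nat -> plane,
    q n @[n --> \oo] --> v & forall n, x n - x 0%N = n.+1%:R *: q n.
  apply: (normx _ (1 + `|x 0%N|)) => n; have [s s1 ->] := xE n.
  exists (s - x 0%N); first by rewrite (le_trans (ler_normB _ _))// lerD2r.
  by rewrite addrAC.
have enq (u : nat -> plane) : u n @[n --> \oo] --> v ->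
    euclidean_norm (u n) @[n --> \oo] --> (1 : R).
  by move=> h; rewrite -v1; exact: (cvg_comp _ _ h (@continuous_euclidean_norm v)).
exists x; split; first by move=> n; case: (xP n).
- apply/cvgryPge => M.
  have h2 : \forall n \near \oo, 2^-1 <= euclidean_norm (q n).
    have /enq/cvgr_ge := qv; apply; lra.
  near=> n; rewrite qE euclidean_normZ//.
  have : 2^-1 <= euclidean_norm (q n) by near: n.
  have : 2 * `|M| <= n.+1%:R.
    apply: (@le_trans _ _ n%:R); last by rewrite ler_nat.
    by near: n; exact: nbhs_infty_ger.
  have := ler_norm M; have := normr_ge0 M; nra.
- rewrite (_ : (fun n => _) = (fun n => (euclidean_norm (q' n))^-1 *: q' n)); last first.
    apply/funext => n; rewrite qE' euclidean_normZ// invfM scalerA mulrAC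
      mulVf ?pnatr_eq0//.
    by rewrite mul1r.
  rewrite -[X in _ --> X]scale1r; apply: cvgZ => //.
  rewrite -invr1; apply: cvgV; first exact: oner_neq0.
  exact: enq.
Unshelve. all: by end_near. Qed.

End directions.


(** * The limit map *)

Section limit_domain.
Context {R : realType}.
Local Notation plane := (R * R)%type.
Variables (H K : nat -> plane -> plane) (eta : nat -> R).
Hypothesis homeoH : forall n, toral_homeo (H n) (K n).
Hypothesis eta_decr : forall n, eta n.+1 <= eta n.
Hypothesis eta_small : forall r : R, 0 < r -> exists n, eta n < r.
Hypothesis H_stable : forall n x, core (eta n) x -> H n.+1 x = H n x.

Lemma core_exhausts x : open_unit_square x -> exists n, core (eta n) x.
Proof.
rewrite -bigcup_core => -[m _ mx].
have [n hn] := eta_small (r := m.+1%:R^-1) (ltac:(by rewrite invr_gt0)).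
by exists n; exact: subset_core (ltW hn) _ mx.
Qed.

Lemma core_nested m n : (m <= n)%N -> core (eta m) `<=` core (eta n).
Proof.
move=> mn; apply: subset_core; elim: n mn => [|n IH]; first by rewrite leqn0 => /eqP ->.
by rewrite leq_eqVlt => /predU1P[->//|/IH]; exact: le_trans.
Qed.

Lemma tower_stable m n x : (m <= n)%N -> core (eta m) x -> H n x = H m x.
Proof.
move=> + mx; elim: n => [|n IH]; first by rewrite leqn0 => /eqP ->.
rewrite leq_eqVlt => /predU1P[->//|mn]; rewrite -IH// H_stable//.
exact: (core_nested (m := m)).
Qed.

Lemma exists_tower_limit :
  exists L : plane -> plane, forall n x, core (eta n) x -> L x = H n x.
Proof.
have hL x : exists z, forall n, core (eta n) x -> z = H n x.
  have [[m mx]|nx] := pselect (exists n, core (eta n) x); last first.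
    by exists x => n nxn; case: nx; exists n.
  exists (H m x) => n nx.
  case/orP: (leq_total m n) => mn; first by rewrite (tower_stable mn mx).
  by rewrite (tower_stable mn nx).
have [L LP] := choice hL.
by exists L => n x; exact: LP.
Qed.

Variable L : plane -> plane.
Hypothesis LE : forall n x, core (eta n) x -> L x = H n x.

Lemma continuous_limit x : open_unit_square x -> {for x, continuous L}.
Proof.
move=> /core_exhausts[n nx].
have near_core : \forall y \near x, core (eta n) y.
  by apply: open_nbhs_nbhs; split => //; exact: open_core.
rewrite /prop_for /continuous_at (LE nx).
apply: cvg_trans (toral_continuous (homeoH n) (x := x)).
apply: near_eq_cvg; apply: filterS near_core => y ny.
by rewrite (LE ny).
Qed.

Lemma image_limit (B : set plane) : B `<=` open_unit_square ->
  L @` B = \bigcup_n (H n @` (B `&` core (eta n))).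
Proof.
move=> sB; apply/seteqP; split => z.
  move=> [x Bx <-]; have [n nx] := core_exhausts (sB _ Bx).
  by exists n => //; exists x => //; rewrite (LE nx).
by move=> [n _ [x [Bx nx] <-]]; exists x => //; rewrite (LE nx).
Qed.

Lemma open_image_limit (B : set plane) :
  open B -> B `<=` open_unit_square -> open (L @` B).
Proof.
move=> oB sB; rewrite image_limit//; apply: bigcup_open => n _.
by apply: (open_toral_image (homeoH n)); apply: openI => //; exact: open_core.
Qed.

(** A common stage of the tower computes both [L x] and [L y], and it is
    equivariant and injective. *)
Lemma limit_lattice x y k : open_unit_square x -> open_unit_square y ->
  L y = L x + lattice_point k -> k = 0 /\ x = y.
Proof.
move=> sx sy; have [m mx] := core_exhausts sx; have [n ny] := core_exhausts sy.
rewrite (LE (core_nested (leq_maxl m n) mx)) (LE (core_nested (leq_maxr m n) ny)).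
rewrite -(toral_lattice (homeoH _)) => /(can_inj (toralK (homeoH _))) yE.
have k0 := open_unit_square_lattice sx sy yE.
by rewrite yE k0 lattice_point0 addr0.
Qed.

End limit_domain.

Theorem theorem2 (R : realType) :
  exists Uhat : set (R * R),
    open Uhat /\
    let U : set (torus R) := torus_proj @` Uhat in
    [/\ connected Uhat /\ simply_connected R Uhat,
        simply_connected R U /\
        (forall k : int * int, k != 0 ->
           Uhat `&` translate (lattice_point k) Uhat = set0),
        forall v : R * R, Uhat `&` translate v unit_square !=set0,
        forall v : R * R, unit_circle v -> clusters_in_direction Uhat v &
        lebesgue_torus U = 1%E].
Proof.
(* stage n aims at the lattice point k at scale 1 / (n + m + 1), where
   (k, m) is the pair coded by n; so every lattice point is approached at
   every scale, and the scales tend to 0 *)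
pose decode n : (int * int) * nat := odflt ((0 : int, 0 : int), 0%N) (unpickle n).
pose e n : R := (n + (decode n).2).+1%:R^-1.
have e0 n : 0 < e n by rewrite invr_gt0.
have e_le n : e n <= n.+1%:R^-1 by rewrite lef_pV2 ?posrE// ler_nat ltnS leq_addr.
have [H [K [eta [homeo_eta eta_le H_stable hits area]]]] :=
  toral_tower (fun n => (decode n).1) e0.
have homeoH n : toral_homeo (H n) (K n) by case: (homeo_eta n).
have eta_decr n : eta n.+1 <= eta n by case: (eta_le n).
have eta_small (r : R) : 0 < r -> exists n, eta n < r.
  move=> r0; have [n _ hn] := near_infty_natSinv_lt (PosNum r0).
  exists n.+1; case: (eta_le n) => _ en.
  exact: le_lt_trans en (le_lt_trans (e_le n) (hn n (leqnn n))).
have [L LE] := exists_tower_limit eta_decr H_stable.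
have cL := continuous_limit homeoH eta_small LE.
have oL := open_image_limit homeoH eta_small LE.
have lL := limit_lattice homeoH eta_decr eta_small LE.
pose Uhat := L @` (@open_unit_square R).
have oU : open Uhat by apply: oL => //; exact: open_open_unit_square.
have coreU n x : core (eta n) x -> Uhat (H n x).
  by move=> nx; exists x; [case: nx|exact: LE].
have meets v : Uhat `&` translate v unit_square !=set0.
  (* the lattice point is the one of the half-open square with corner v, hence
     it leaves some room above it and to its right *)
  have ceilP (a : R) : a <= (- Num.floor (- a))%:~R < a + 1.
    have := floor_itv (- a); rewrite intrN intrD => /andP[l u].
    by apply/andP; split; lra.
  have /andP[l1 u1] := ceilP v.1; have /andP[l2 u2] := ceilP v.2.
  set k1 : int := (- Num.floor (- v.1))%R in l1 u1 *.
  set k2 : int := (- Num.floor (- v.2))%R in l2 u2 *.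
  have room : 0 < Num.min (v.1 + 1 - k1%:~R) (v.2 + 1 - k2%:~R).
    by rewrite lt_min !subr_gt0 u1.
  have [m _ hm] := near_infty_natSinv_lt (PosNum room).
  have {hm} := hm m (leqnn m); rewrite /= lt_min => /andP[m1 m2].
  pose n := pickle ((k1, k2), m).
  have decn : decode n = ((k1, k2), m) by rewrite /decode /n pickleK.
  have em : e n <= m.+1%:R^-1.
    by rewrite lef_pV2 ?posrE// ler_nat decn ltnS leq_addl.
  have {}m1 := le_lt_trans em m1; have {}m2 := le_lt_trans em m2.
  have [p [np]] := hits n; rewrite /corner_box decn /= => -[/andP[a1 b1] /andP[a2 b2]].
  exists (H n.+1 p); split; first exact: coreU np.
  exists (H n.+1 p - v); last by rewrite subrK.
  by split; rewrite /= in_itv/=; apply/andP; split; lra.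
have scU : simply_connected R Uhat.
  apply: simply_connected_image => //.
  - move=> x y /[!inE] sx sy Lxy.
    by have [] := lL x y 0 sx sy; rewrite ?lattice_point0 ?addr0.
  - exact: open_open_unit_square.
  - exact: simply_connected_open_unit_square.
exists Uhat; split => //; split.
- by split => //; exact: simply_connected_connected scU.
- split.
    rewrite /Uhat image_comp; apply: simply_connected_image.
    + move=> x sx; apply: continuous_comp; first exact: cL.
      exact: continuous_torus_proj.
    + move=> x y /[!inE] sx sy /torus_projP[k Lxy].
      by have [] := lL x y k sx sy Lxy.
    + by move=> B oB sB; rewrite -image_comp; apply: open_torus_proj; exact: oL.
    + exact: open_open_unit_square.
    + exact: simply_connected_open_unit_square.
  move=> k k0; rewrite -subset0 => z [[y sy <-] [_ [x sx <-] /esym Lxy]].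
  by have [kz _] := lL _ _ _ sx sy Lxy; rewrite kz eqxx in k0.
- exact: meets.
- by move=> v; exact: meets_squares_clusters.
- have mU : measurable (torus_proj @` Uhat).
    by apply: measurable_open_torus; exact: open_torus_proj.
  apply/eqP; rewrite eq_le probability_le1//=.
  apply/lee_addgt0Pr => r r0.
  have [n _ hn] := near_infty_natSinv_lt (PosNum r0).
  have er : e n <= r := le_trans (e_le n) (ltW (hn n (leqnn n))).
  apply: (@le_trans _ _ ((1 - e n)%:E + r%:E)%E).
    by rewrite -EFinD lee_fin; lra.
  apply: leeD => //; apply: le_trans (area n) _.
  apply: (le_measure (@lebesgue_torus R)); rewrite ?inE//.
    apply: measurable_open_torus; apply: open_torus_proj.
    by apply: (open_toral_image (homeoH n.+1)); exact: open_core.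
  by apply: image_subset => z [x nx <-]; exact: coreU nx.
Qed.
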